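(* There exist a Tonelli Lagrangian $L:T\mathbb T^2\to\mathbb R$ on the two-torus and two disjoint non-empty closed connected submanifolds $Q_0,Q_1\subseteq\mathbb T^2$ such that $c_u(L)<c(L;Q_0,Q_1)$ and such that there are no connecting orbits having energy $k\le c(L;Q_0,Q_1)$. Moreover, there are points $q_0\in Q_0$ and $q_1\in Q_1$ such that there are no Euler-Lagrange orbits connecting them with energy $k\le c_u(L)$.
   Context: Let $M=\mathbb T^2$. A Tonelli Lagrangian is a smooth function $L:TM\to\mathbb R$ that is fiberwise $C^2$-strictly convex ($d_{vv}L>0$) and fiberwise superlinear. Energy: $E(q,v)=d_vL(q,v)\cdot v-L(q,v)$, constant along Euler-Lagrange orbits (solutions of $\frac{d}{dt}\partial_vL(\gamma,\dot\gamma)-\partial_qL(\gamma,\dot\gamma)=0$). A connecting orbit is an Euler-Lagrange orbit $\gamma:[0,R]\to M$, $R>0$, satisfying the conormal boundary conditions: $\gamma(0)\in Q_0$, $\gamma(R)\in Q_1$, $d_vL(\gamma(0),\dot\gamma(0))|_{T_{\gamma(0)}Q_0}=0$, $d_vL(\gamma(R),\dot\gamma(R))|_{T_{\gamma(R)}Q_1}=0$. Let $H(q,p)=\max_{v\in T_qM}[\langle p,v\rangle-L(q,v)]$ and $\widetilde M$ the universal cover of $M$. Let $G<\pi_1(M)$ be the smallest normal subgroup containing the images of $\pi_1(Q_0)$ and $\pi_1(Q_1)$ under the inclusions, $M'=\widetilde M/G$ and $H'$ the lift of $H$ to $T^*M'$. Then $c(L;Q_0,Q_1):=\inf_{u\in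 C^\infty(M')}\sup_{q\in M'}H'(q,d_qu)$, and $c_u(L)$ (Mañé critical value of the universal cover) is defined by the same formula with $M'$ replaced by $\widetilde M$. *)

(* Defs.v *)
From HB Require Import structures.
From mathcomp Require Import all_boot all_order all_algebra.
From mathcomp Require Import all_classical all_reals all_analysis.

Set Implicit Arguments.
Unset Strict Implicit.
Unset Printing Implicit Defensive.
Import Order.TTheory GRing.Theory Num.Theory.
Import numFieldNormedType.Exports.

Local Open Scope classical_set_scope.
Local Open Scope ring_scope.

(** For finite-dimensional [V] and open [U] this is the usual class C^n: [f] is
    C^(n+1) iff it is differentiable and [fun x => 'd f x v] is C^n for all
    [v]. *)
Fixpoint class_C {R : realType} {V W : normedModType R} (n : nat) (U : set V)
    (f : V -> W) : Prop :=
  match n with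
  | 0 => forall x, U x -> {for x, continuous f}
  | n'.+1 => (forall x, U x -> differentiable f x) /\
             forall v, class_C n' U ('D_v f)
  end.

Definition smooth_on {R : realType} {V W : normedModType R} (U : set V)
  (f : V -> W) : Prop := forall n, class_C n U f.

(** The fundamental group of the torus is identified with ['rV[int]_2], acting
    on the universal cover ['rV[R]_2] by the translations [x |-> x + intv m]. *)
Definition intv (R : realType) (m : 'rV[int]_2) : 'rV[R]_2 := map_mx intr m.

Definition torus_rel (R : realType) : rel 'rV[R]_2 :=
  fun x y => `[< exists m : 'rV[int]_2, y = x + intv R m >].
Arguments torus_rel : clear implicits.

Lemma torus_rel_refl (R : realType) : reflexive (torus_rel R).
Proof. by move=> x; apply/asboolP; exists 0; rewrite /intv map_mx0 addr0. Qed.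

Lemma torus_rel_sym (R : realType) : symmetric (torus_rel R).
Proof.
suff H x y : torus_rel R x y -> torus_rel R y x.
  by move=> x y; apply/idP/idP; apply: H.
move=> /asboolP[m ->]; apply/asboolP; exists (- m).
by rewrite /intv map_mxN addrK.
Qed.

Lemma torus_rel_trans (R : realType) : transitive (torus_rel R).
Proof.
move=> y x z /asboolP[m ->] /asboolP[n ->]; apply/asboolP; exists (m + n).
by rewrite /intv map_mxD addrA.
Qed.

Canonical torus_equiv (R : realType) :=
  EquivRel (torus_rel R) (@torus_rel_refl R) (@torus_rel_sym R)
    (@torus_rel_trans R).

Definition torus (R : realType) : topologicalType :=
  quotient_topology {eq_quot torus_equiv R}%qT.

Definition tpi {R : realType} (x : 'rV[R]_2) : torus R :=
  (\pi_(quotient_topology {eq_quot torus_equiv R}) x)%qT.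

Section Torus.
Context {R : realType}.
Local Notation V := 'rV[R]_2.
Local Notation T2 := (torus R).

(** A slice chart around each point; the projection being a local
    diffeomorphism, the charts are taken on the universal cover.  Slice charts
    leave no room for a boundary, so "closed" means compact. *)
Definition slice_chart (d : nat) (Q : set T2) (U W : set V) (phi psi : V -> V) :=
  [/\ open U, open W, smooth_on U phi & smooth_on W psi] /\
  [/\ forall y, U y -> W (phi y) /\ psi (phi y) = y,
      forall z, W z -> U (psi z) /\ phi (psi z) = z &
      forall y, U y ->
        (Q (tpi y) <-> forall i : 'I_2, (d <= i)%N -> phi y 0 i = 0)].

Definition submanifold (d : nat) (Q : set T2) : Prop :=
  forall x : V, Q (tpi x) ->
    exists U W phi psi, U x /\ slice_chart d Q U W phi psi.

Definition closed_connected_submanifold (Q : set T2) : Prop :=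
  [/\ exists2 d : nat, (d <= 2)%N & submanifold d Q, compact Q & connected Q].

(** The tangent space of [Q] at [tpi x], as a subspace of the tangent space of
    the torus, which is identified with [V] through the differential of [tpi]
    at [x]. *)
Definition tangent_space (Q : set T2) (x : V) : set V :=
  [set xi | exists (e : R) (c : R -> V),
    [/\ 0 < e, smooth_on `]-e, e[ c, forall t : R, t \in `]-e, e[ -> Q (tpi (c t)),
        c 0 = x & is_derive (0 : R) 1 c xi]].

(** The tangent bundle of the torus is [T2 * V]: [L q v] stands for the value of
    the Lagrangian at the tangent vector [v] based at [q]. *)
Record tonelli (L : T2 -> V -> R) : Prop := Tonelli {
  tonelli_smooth : smooth_on setT (fun z : V * V => L (tpi z.1) z.2);
  tonelli_convex : forall q v xi, xi != 0 -> 0 < 'D_xi ('D_xi (L q)) v;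
  tonelli_superlinear : forall q (A : R), exists r : R,
    forall v, r < `|v| -> A < L q v / `|v| }.

Definition dvL (L : T2 -> V -> R) (q : T2) (v xi : V) : R := 'D_xi (L q) v.

Definition dqL (L : T2 -> V -> R) (x v xi : V) : R :=
  'D_xi (fun y => L (tpi y) v) x.

Definition energy (L : T2 -> V -> R) (q : T2) (v : V) : R :=
  dvL L q v v - L q v.

(** The curve [tpi \o x] on the interval [[0, T]] is given by its lift [x], and
    [w] is its velocity: continuity of [w] up to the endpoints makes [w 0] and
    [w T] the one-sided derivatives of [x] there.  Nothing is asked of [x] and
    [w] outside of the interval. *)
Record EL_orbit (L : T2 -> V -> R) (T : R) (x w : R -> V) : Prop := ELOrbit {
  EL_cont : {within `[0, T], continuous x};
  EL_vel_cont : {within `[0, T], continuous w};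
  EL_vel : forall t : R, t \in `]0, T[ -> is_derive t 1 x (w t);
  EL_eq : forall t : R, t \in `]0, T[ -> forall xi,
    is_derive t 1 (fun s => dvL L (tpi (x s)) (w s) xi) (dqL L (x t) (w t) xi) }.

Definition has_energy (L : T2 -> V -> R) (T k : R) (x w : R -> V) : Prop :=
  forall t : R, t \in `[0, T] -> energy L (tpi (x t)) (w t) = k.

Definition conormal (L : T2 -> V -> R) (Q : set T2) (x v : V) : Prop :=
  forall xi, tangent_space Q x xi -> dvL L (tpi x) v xi = 0.

Definition connecting_orbit (L : T2 -> V -> R) (Q0 Q1 : set T2) (T : R)
    (x w : R -> V) : Prop :=
  [/\ 0 < T, EL_orbit L T x w, Q0 (tpi (x 0)) /\ Q1 (tpi (x T)),
      conormal L Q0 (x 0) (w 0) & conormal L Q1 (x T) (w T)].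

Definition hamiltonian (L : T2 -> V -> R) (q : T2) (p : {linear V -> R}) : \bar R :=
  ereal_sup [set (p v - L q v)%:E | v in setT].

(** Image in the fundamental group of the torus of the classes of the loops
    [tpi \o c] in [Q]: a loop acts on the universal cover by the translation
    from the initial to the final point of its lift [c].  As the group is
    abelian, base points are irrelevant for connected [Q]. *)
Definition pi1_image (Q : set T2) : set 'rV[int]_2 :=
  [set m | exists c : R -> V,
    [/\ {within `[0, 1], continuous c},
        forall t : R, t \in `[0, 1] -> Q (tpi (c t)) & c 1 = c 0 + intv R m]].

Definition normal_subgroup (G : set 'rV[int]_2) : Prop :=
  [/\ G 0, forall g h, G g -> G h -> G (g - h) &
      forall a g, G g -> G (a + g - a)].

Definition pi1_normal_closure (Q0 Q1 : set T2) : set 'rV[int]_2 :=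
  smallest normal_subgroup (pi1_image Q0 `|` pi1_image Q1).

(** The smooth functions on the quotient of the universal cover by [G], given
    by their lifts. *)
Definition smooth_invariant (G : set 'rV[int]_2) : set (V -> R) :=
  [set u | smooth_on setT u /\ forall g x, G g -> u (x + intv R g) = u x].

Definition critical_value_cover (L : T2 -> V -> R) (G : set 'rV[int]_2) : \bar R :=
  ereal_inf [set ereal_sup [set hamiltonian L (tpi x) ('d u x) | x in setT]
            | u in smooth_invariant G].

Definition critical_value (L : T2 -> V -> R) (Q0 Q1 : set T2) : \bar R :=
  critical_value_cover L (pi1_normal_closure Q0 Q1).

Definition universal_critical_value (L : T2 -> V -> R) : \bar R :=
  critical_value_cover L [set 0].

End Torus.

(* Main.v *)
Require Import Defs.
From HB Require Import structures.
From mathcomp Require Import all_boot all_order all_algebra.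
From mathcomp Require Import all_classical all_reals all_analysis.
From mathcomp Require Import ring lra zify.
Import Order.TTheory GRing.Theory Num.Theory.
Import numFieldNormedType.Exports.
Local Open Scope classical_set_scope.
Local Open Scope ring_scope.

(** The Lagrangian is magnetic, [L (q, v) = |v|^2 / 2 + sin^2 (pi q_0) v_1],
    with [Q_0 = {q_0 = 0}] and [Q_1 = {q_0 = 1/2}], the circles where the
    magnetic potential is extremal. The critical value [c (L; Q_0, Q_1)] is
    [1/2]: the zero function gives the upper bound, and a function on the
    cylinder has a critical point along the lift of [Q_1], where the potential
    is [1]. On the universal cover [u q = q_1 / 2] recentres the potential, so
    that [c_u (L) <= 1/8].

    The momentum [P = v_1 + sin^2 (pi q_0)] is conserved and the energy is
    [|v|^2 / 2 = k], whence [v_0^2 = 2k - (P - sin^2 (pi q_0))^2]. In both cases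
    ([P = 0] by the conormal condition and [k <= 1/2], or [k <= 1/8]), an orbit
    which meets both circles must have the energy for which this gives
    [v_0^2 <= 2 cos^2 (pi q_0)]. Then [cos (pi q_0)], which vanishes on [Q_1]
    and not on [Q_0], satisfies a linear differential inequality and cannot
    vanish in finite time. *)

(** * Smoothness of affine maps, sums, products, and sine and cosine of linear forms *)

Section Smoothness.
Context {R : realType}.

(** Serves the product rule, where each factor reappears undifferentiated and is needed one class
    lower. *)
Lemma class_C_pred {V W : normedModType R} n (U : set V) (f : V -> W) :
  class_C n.+1 U f -> class_C n U f.
Proof.
elim: n f => [|n IHn] f [df Df].
  by move=> x Ux; apply: differentiable_continuous; exact: df.
by split=> // v; apply/IHn/Df.
Qed.

Lemma smooth_cst {V W : normedModType R} (U : set V) (c : W) :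
  smooth_on U (cst c).
Proof.
move=> n; elim: n c => [|n IHn] c; first by move=> x _; exact: cst_continuous.
split=> [x _|v]; first exact: differentiable_cst.
rewrite (_ : 'D_v (cst c) = cst 0); first exact: IHn.
by apply/funext => x; rewrite derive_cst.
Qed.

Lemma smooth_affine {V W : normedModType R} (U : set V) (f : {linear V -> W})
    (c : W) :
  continuous f -> smooth_on U (fun x => f x + c).
Proof.
move=> cf.
have dl x : differentiable f x by exact: linear_differentiable.
have dfc x : differentiable (fun x => f x + c) x.
  by apply: (@differentiableD _ _ _ f (cst c)) => //; exact: differentiable_cst.
case=> [|n]; first by move=> x _; exact: differentiable_continuous.
split=> [x _|v]; first exact: dfc.
rewrite (_ : 'D_v _ = cst (f v)); first exact: smooth_cst.
apply/funext => x; rewrite (@deriveD _ _ _ f (cst c)); last 2 first.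
- exact: diff_derivable.
- exact: derivable_cst.
by rewrite derive_cst addr0 deriveE // diff_lin.
Qed.

Lemma smooth_linear {V W : normedModType R} (U : set V) (f : {linear V -> W}) :
  continuous f -> smooth_on U f.
Proof.
move=> cf; rewrite (_ : (f : V -> W) = fun x => f x + 0).
  exact: smooth_affine.
by apply/funext => x; rewrite addr0.
Qed.

Lemma class_CD {V : normedModType R} n (f g : V -> R) :
  class_C n setT f -> class_C n setT g -> class_C n setT (f + g).
Proof.
elim: n f g => [|n IHn] f g.
  by move=> sf sg x _; apply: continuousD; by [exact: sf | exact: sg].
move=> [df Df] [dg Dg]; split=> [x _|v].
  by apply: differentiableD; [exact: df | exact: dg].
rewrite (_ : 'D_v (f + g) = 'D_v f + 'D_v g); last first.
  by apply/funext => x; rewrite deriveD //;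
    apply: diff_derivable; by [exact: df|exact: dg].
by apply: IHn; [exact: Df|exact: Dg].
Qed.

Lemma class_CM {V : normedModType R} n (f g : V -> R) :
  class_C n setT f -> class_C n setT g -> class_C n setT (f * g).
Proof.
elim: n f g => [|n IHn] f g sf sg.
  by move=> x _; apply: continuousM; [exact: sf | exact: sg].
have [[df Df] [dg Dg]] := (sf, sg); split=> [x _|v].
  by apply: differentiableM; [exact: df | exact: dg].
rewrite (_ : 'D_v (f * g) = f * 'D_v g + g * 'D_v f).
  by apply: class_CD; apply: IHn; by [exact: class_C_pred|exact: Df|exact: Dg].
by apply/funext => x; rewrite deriveM //;
    apply: diff_derivable; by [exact: df|exact: dg].
Qed.

Lemma derive_comp_linear {V : normedModType R} (l : {linear V -> R})
    (h dh : R -> R) x v :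
  continuous l -> (forall y : R, is_derive y (1 : R) h (dh y)) ->
  differentiable (h \o l) x /\ 'D_v (h \o l) x = l v * dh (l x).
Proof.
move=> cl dhE.
have dl : differentiable l x by exact: linear_differentiable.
have dhl : differentiable h (l x) by apply/derivable1_diffP; exact: ex_derive.
have dc : differentiable (h \o l) x by exact: differentiable_comp.
split=> //; rewrite deriveE // diff_comp //= diff_lin // deriv1E.
  by rewrite derive1E derive_val.
exact: ex_derive.
Qed.

(** Sine and cosine go through one simultaneous induction, since each directional derivative is a
    constant multiple of the other function. *)
Lemma smooth_sin_cos_linear {V : normedModType R} (l : {linear V -> R}) :
  continuous l -> smooth_on setT (sin \o l) /\ smooth_on setT (cos \o l).
Proof.
move=> cl.
suff H n : class_C n setT (sin \o l) /\ class_C n setT (cos \o l).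
  by split=> n; case: (H n).
have dsin x v := derive_comp_linear l sin cos x v cl (@is_derive_sin R).
have dcos x v := derive_comp_linear l cos (fun y => - sin y) x v cl (@is_derive_cos R).
elim: n => [|n [IHs IHc]].
  by split=> x _; apply: differentiable_continuous;
    [case: (dsin x 0)|case: (dcos x 0)].
split; split=> [x _|v].
- by case: (dsin x 0).
- rewrite (_ : 'D_v _ = cst (l v) * (cos \o l)); last first.
    by apply/funext => x; case: (dsin x v).
  by apply: class_CM IHc; exact: smooth_cst.
- by case: (dcos x 0).
- rewrite (_ : 'D_v _ = cst (- l v) * (sin \o l)); last first.
    by apply/funext => x; case: (dcos x v) => _ ->; rewrite mulrN [RHS]mulNr.
  by apply: class_CM IHs; exact: smooth_cst.
Qed.

End Smoothness.

(** * Coordinates on the torus and the circles [circle a] *)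

Definition pcoord {R : realType} (i : 'I_2) (x : 'rV[R]_2) : R := x 0 i.

Section Coordinates.
Context {R : realType}.
Local Notation V := 'rV[R]_2.

Fact pcoord_is_linear i : linear (@pcoord R i).
Proof. by move=> a u v; rewrite /pcoord !mxE. Qed.

HB.instance Definition _ i :=
  GRing.isLinear.Build R V R *:%R (@pcoord R i) (pcoord_is_linear i).

Lemma pcoord_continuous i : continuous (@pcoord R i).
Proof. exact: coord_continuous. Qed.

Definition pt (a b : R) : V := \row_(j < 2) (if j == 0 then a else b).

Lemma pt0 a b : pcoord 0 (pt a b) = a.
Proof. by rewrite /pcoord mxE eqxx. Qed.

Lemma pt1 a b : pcoord 1 (pt a b) = b.
Proof. by rewrite /pcoord mxE. Qed.

Lemma ord2_cases (i : 'I_2) : i = 0 \/ i = 1.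
Proof. by case: i => [[|[]]] // ?; [left|right]; exact/val_inj. Qed.

Lemma pcoord_ext (x y : V) :
  pcoord 0 x = pcoord 0 y -> pcoord 1 x = pcoord 1 y -> x = y.
Proof.
by move=> x0 x1; apply/rowP => i; have [->|->] := ord2_cases i.
Qed.

Lemma pcoord_norm (x : V) i : `|pcoord i x| <= `|x|.
Proof.
rewrite [leRHS]/Num.Def.normr/= mx_normrE.
exact: (le_bigmax _ (fun k : 'I_1 * 'I_2 => `|x k.1 k.2|) (0, i)).
Qed.

Lemma norm_pcoord (x : V) : x != 0 -> exists i, `|x| = `|pcoord i x|.
Proof.
rewrite -normr_eq0 => /mx_norm_neq0[[i j] xE]; exists j.
by rewrite /pcoord -(ord1 i).
Qed.

Lemma tpiP (x y : V) : tpi x = tpi y <-> exists m, y = x + intv R m.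
Proof.
split=> [/(@eqmodP _ (torus_equiv R))/asboolP//|xy].
by apply/(@eqmodP _ (torus_equiv R)); apply/asboolP.
Qed.

Lemma tpi_continuous : continuous (@tpi R).
Proof. exact: pi_continuous. Qed.

Lemma tpi_surj (q : torus R) : exists x, q = tpi x.
Proof. by exists (repr q); rewrite /tpi reprK. Qed.

Lemma pcoord_intv i (m : 'rV[int]_2) : pcoord i (intv R m) = (m 0 i)%:~R.
Proof. by rewrite /pcoord mxE. Qed.

Definition sqsin (a : R) : R := sin (pi * a) ^+ 2.

(** A unit shift changes the sign of [sin (pi * a)], which the square absorbs; a negative shift is
    undone by a positive one. *)
Lemma sqsinDint a (m : int) : sqsin (a + m%:~R) = sqsin a.
Proof.
have H n b : sqsin (b + n%:R) = sqsin b.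
  elim: n => [|n IHn]; first by rewrite addr0.
  by rewrite -natr1 addrA /sqsin mulrDr mulr1 sinDpi sqrrN; exact: IHn.
case: m => n; first exact: H.
by rewrite -(H n.+1) NegzE mulrNz subrK.
Qed.

(** As the image of a segment, the circle is compact and connected at once; [circleP] recovers the
    description by the first coordinate. *)
Definition circle (a : R) : set (torus R) := [set tpi (pt a t) | t in `[0, 1]].

Lemma circleP a x : circle a (tpi x) <-> exists m : int, pcoord 0 x = a + m%:~R.
Proof.
split=> [[t _ /tpiP[m ->]]|[m xm]].
  by exists (m 0 0); rewrite linearD/= pt0 pcoord_intv.
(* The fractional part of the second coordinate is the parameter in [[0, 1]]. *)
exists (pcoord 1 x - (Num.floor (pcoord 1 x))%:~R).
  rewrite /= in_itv/= subr_ge0 floor_le_tmp lerBlDr -[1 in leRHS]/(1%:~R) -intrD addrC.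
  by rewrite ltW// floorD1_gt.
apply/tpiP; exists (\row_j (if j == 0 then m else Num.floor (pcoord 1 x))).
by apply: pcoord_ext; rewrite linearD/= ?pt0 ?pt1 pcoord_intv mxE/= ?subrK.
Qed.

Lemma smooth_line (U : set R) (x : V) : smooth_on U (fun t => x + t *: pt 0 1).
Proof.
rewrite (_ : (fun t => _) = fun t => t *: pt 0 1 + x); last first.
  by apply/funext => t; rewrite addrC.
have lf : linear (fun t : R => t *: pt 0 1).
  by move=> a u v; rewrite scalerDl scalerA.
pose fL : {linear R -> V} := HB.pack (fun t : R => t *: pt 0 1)
  (GRing.isLinear.Build R R V _ _ lf).
by apply: (@smooth_affine R R V U fL x); exact: scalel_continuous.
Qed.

Lemma pt_continuous a : continuous (pt a).
Proof.
move=> t; have -> : pt a = fun t => pt a 0 + t *: pt 0 1.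
  apply/funext => s; apply: pcoord_ext; rewrite linearD linearZ/= ?pt0 ?pt1.
    by rewrite scaler0 addr0.
  by rewrite add0r [_ *: 1]mulr1.
exact: (smooth_line setT (pt a 0) 0).
Qed.

Lemma circle_curve_continuous a : continuous (fun t => tpi (pt a t)).
Proof.
by move=> t; apply: continuous_comp; [exact: pt_continuous|exact: tpi_continuous].
Qed.

(** Slice charts of dimension 1 require the last coordinate to vanish on the submanifold, while
    [circle a] fixes the first one. The chart therefore swaps the coordinates, and its inverse has
    the same shape. *)
Lemma smooth_swap (U : set V) b c :
  smooth_on U (fun y : V => pt (pcoord 1 y + b) (pcoord 0 y + c)).
Proof.
pose f (y : V) := pcoord 1 y *: pt 1 0 + pcoord 0 y *: pt 0 1.
have lf : linear f.
  move=> a u v; have pE i : pcoord i (a *: u + v) = a * pcoord i u + pcoord i v.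
    by rewrite linearP.
  by rewrite /f !pE !scalerDl scalerDr !scalerA addrACA.
pose fL : {linear V -> V} := HB.pack f (GRing.isLinear.Build _ _ _ _ f lf).
have -> : (fun y : V => pt (pcoord 1 y + b) (pcoord 0 y + c)) = fun y => fL y + pt b c.
  by apply/funext => y; apply: pcoord_ext; rewrite linearD /fL /= /f
    linearD/= !linearZ/= ?pt0 ?pt1 [_ *: 1]mulr1 [_ *: 0]mulr0 ?addr0 ?add0r.
have cZ i (v y : V) : {for y, continuous (fun z => pcoord i z *: v)}.
  by apply: continuousZr_tmp; exact: pcoord_continuous.
apply: smooth_affine => y.
by apply: (@continuousD _ _ _ (fun z => pcoord 1 z *: pt 1 0)
  (fun z => pcoord 0 z *: pt 0 1)); exact: cZ.
Qed.

Lemma open_strip i (b : R) : open [set y : V | `|pcoord i y - b| < 2^-1].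
Proof.
rewrite (_ : mkset _ = pcoord i @^-1` ball b (2^-1)).
  apply: open_comp; first by move=> ? _; exact: pcoord_continuous.
  exact: ball_open.
by apply/seteqP; split => y /=; rewrite /ball/= distrC.
Qed.

Lemma circle_submanifold a : closed_connected_submanifold (circle a).
Proof.
split.
- exists 1%N => // x /circleP[m xm].
  pose b := a + m%:~R.
  (* The lifts of the circle are at mutual distance at least 1, so a strip of half-width 1/2 about
     one of them meets no other. *)
  exists [set y : V | `|pcoord 0 y - b| < 2^-1],
    [set y : V | `|pcoord 1 y - 0| < 2^-1].
  exists (fun y => pt (pcoord 1 y + 0) (pcoord 0 y + - b)),
    (fun y => pt (pcoord 1 y + b) (pcoord 0 y + 0)).
  split; first by rewrite /= xm subrr normr0 invr_gt0.
  split; first by split; by [exact: open_strip|exact: smooth_swap].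
  split.
  + move=> y /= yb; rewrite pt1 subr0; split => //.
    by apply: pcoord_ext; rewrite ?pt0 ?pt1 ?addr0 ?subrK.
  + move=> y /= yb; rewrite pt0 addrK; split; first by rewrite subr0 in yb.
    by apply: pcoord_ext; rewrite ?pt0 ?pt1 ?addr0 ?addrK.
  + move=> y /= yb; split.
      move=> /circleP[n yn] i; have [->//|->_] := ord2_cases i.
      rewrite -/(pcoord 1 _) pt1; move: yb; rewrite yn /b.
      rewrite opprD addrACA subrr add0r -intrB => yb.
      (* An integer of absolute value less than 1/2 is zero. *)
      suff -> : n - m = 0 by [].
      apply/eqP; rewrite -normr_le0 -ltzD1 add0r -(@ltr_int R) intr_norm.
      by apply: lt_trans yb _; rewrite invf_lt1 ?ltr1n.
    move=> /(_ 1 isT); rewrite -/(pcoord 1 _) pt1 => /eqP; rewrite subr_eq0 => /eqP yb0.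
    by apply/circleP; exists m.
- apply: continuous_compact; last exact: segment_compact.
  exact/continuous_subspaceT/circle_curve_continuous.
- apply: connected_continuous_connected; last first.
    exact/continuous_subspaceT/circle_curve_continuous.
  exact: segment_connected.
Qed.

Lemma is_derive_line (x v : V) (t : R) : is_derive t 1 (fun s => x + s *: v) v.
Proof.
have -> : (fun s => x + s *: v) = cst x + *:%R^~ v by [].
have [dv vE] := is_diff_scalel t v.
rewrite -{2}[v]add0r; apply: is_deriveD; split; first exact: diff_derivable.
by rewrite deriveE// vE scale1r.
Qed.

Lemma circle_tangent a x : circle a (tpi x) -> tangent_space (circle a) x (pt 0 1).
Proof.
move=> /circleP[m xm]; exists 1, (fun t => x + t *: pt 0 1); split => //.
- exact: smooth_line.
- move=> t _; apply/circleP; exists m.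
  by rewrite linearD linearZ/= pt0 scaler0 addr0.
- by rewrite scale0r addr0.
- exact: is_derive_line.
Qed.

End Coordinates.

(** * The magnetic Lagrangian, its derivatives and the Tonelli conditions *)

Section Lagrangian.
Context {R : realType}.
Local Notation V := 'rV[R]_2.

Lemma sqsin_ge0 (a : R) : 0 <= sqsin a. Proof. exact: sqr_ge0. Qed.

Lemma sqsin_cos (a : R) : sqsin a = 1 - cos (pi * a) ^+ 2.
Proof. exact: sin2cos2. Qed.

Lemma sqsin_le1 (a : R) : sqsin a <= 1.
Proof. by rewrite sqsin_cos gerBl sqr_ge0. Qed.

(** The choice of representative is harmless because [sqsin] has period 1; [lagE] evaluates the
    function at any lift. *)
Definition lag (q : torus R) (v : V) : R :=
  2^-1 * (pcoord 0 v ^+ 2 + pcoord 1 v ^+ 2)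
  + sqsin (pcoord 0 (repr q)) * pcoord 1 v.

Lemma lagE x v : lag (tpi x) v =
  2^-1 * (pcoord 0 v ^+ 2 + pcoord 1 v ^+ 2) + sqsin (pcoord 0 x) * pcoord 1 v.
Proof.
have [m mE] : exists m, repr (tpi x) = x + intv R m.
  by apply/tpiP; rewrite [RHS]reprK.
by rewrite /lag mE linearD/= pcoord_intv sqsinDint.
Qed.

Lemma is_derive_pcoord i (x v : V) : is_derive x v (pcoord i) (pcoord i v).
Proof.
have dl : differentiable (pcoord i : V -> R) x.
  exact/linear_differentiable/pcoord_continuous.
split; first exact: diff_derivable.
by rewrite deriveE// diff_lin//; exact: pcoord_continuous.
Qed.

Lemma is_derive_lag q (v xi : V) : is_derive v xi (lag q)
  (pcoord 0 v * pcoord 0 xi + (pcoord 1 v + sqsin (pcoord 0 (repr q))) * pcoord 1 xi).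
Proof.
have d0 := is_derive_pcoord 0 v xi; have d1 := is_derive_pcoord 1 v xi.
have -> : lag q = 2^-1 \*: (pcoord 0 * pcoord 0 + pcoord 1 * pcoord 1)
    + sqsin (pcoord 0 (repr q)) \*: pcoord 1.
  by apply/funext => y; rewrite /lag !expr2.
by apply: is_derive_eq; rewrite /GRing.scale/=; field.
Qed.

Lemma dvL_lag x (v xi : V) : dvL lag (tpi x) v xi =
  pcoord 0 v * pcoord 0 xi + (pcoord 1 v + sqsin (pcoord 0 x)) * pcoord 1 xi.
Proof.
rewrite /dvL (_ : lag (tpi x) = fun v => lag (tpi x) v)//.
have := is_derive_lag (tpi x) v xi.
(* At the velocity [pt 0 1], cancelling the kinetic terms identifies the potential at the
   representative with the potential at [x]. *)
have := lagE x (pt 0 1); rewrite /lag pt0 pt1 !mulr1 => /addrI ->.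
by move=> /@derive_val.
Qed.

(** The magnetic term is linear in the velocity and cancels from the energy. *)
Lemma energy_lag x v :
  energy lag (tpi x) v = 2^-1 * (pcoord 0 v ^+ 2 + pcoord 1 v ^+ 2).
Proof. by rewrite /energy dvL_lag lagE; field. Qed.

(** The second coordinate is cyclic: the potential depends on the first one only. This is the source
    of the conserved momentum. *)
Lemma dqL_lag x v : dqL lag x v (pt 0 1) = 0.
Proof.
rewrite /dqL /derive (_ : (fun h => _) = cst 0); first exact: lim_cst.
apply/funext => h /=; rewrite !lagE.
have -> : pcoord 0 (h *: pt 0 1 + x) = pcoord 0 x.
  by rewrite linearD linearZ/= pt0 [_ *: 0]mulr0 add0r.
by rewrite subrr scaler0.
Qed.

Lemma lag_tonelli : tonelli lag.
Proof.
split.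
- rewrite (_ : (fun z => _) =
    cst 2^-1 * ((pcoord 0 \o snd) * (pcoord 0 \o snd)
      + (pcoord 1 \o snd) * (pcoord 1 \o snd)) +
    (sin \o (pi \*: (pcoord 0 \o fst))) * (sin \o (pi \*: (pcoord 0 \o fst)))
    * (pcoord 1 \o snd)); last first.
    by apply/funext => z; rewrite lagE !expr2.
  have csnd i : continuous (@pcoord R i \o (@snd V V)).
    by move=> z; apply: continuous_comp; [exact: cvg_snd|exact: pcoord_continuous].
  have cfst i : continuous (@pcoord R i \o (@fst V V)).
    by move=> z; apply: continuous_comp; [exact: cvg_fst|exact: pcoord_continuous].
  have ssnd i : smooth_on setT (@pcoord R i \o (@snd V V)).
    by apply: smooth_linear; exact: csnd.
  have ssin : smooth_on setT (sin \o (pi \*: (@pcoord R 0 \o (@fst V V)))).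
    apply: (proj1 (smooth_sin_cos_linear _ _)) => z.
    by apply: cvgZl_tmp; exact: cfst.
  move=> n; apply: class_CD; apply: class_CM.
  + exact: smooth_cst.
  + by apply: class_CD; apply: class_CM; exact: ssnd.
  + by apply: class_CM; exact: ssin.
  + exact: ssnd.
- move=> q v xi xi0.
  have -> : 'D_xi (lag q) = fun v => pcoord 0 v * pcoord 0 xi
      + (pcoord 1 v + sqsin (pcoord 0 (repr q))) * pcoord 1 xi.
    by apply/funext => y; have /@derive_val := is_derive_lag q y xi.
  have -> : 'D_xi (fun v => pcoord 0 v * pcoord 0 xi
      + (pcoord 1 v + sqsin (pcoord 0 (repr q))) * pcoord 1 xi) v =
      pcoord 0 xi ^+ 2 + pcoord 1 xi ^+ 2.
    have d0 := is_derive_pcoord 0 v xi; have d1 := is_derive_pcoord 1 v xi.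
    have -> : (fun v => pcoord 0 v * pcoord 0 xi
      + (pcoord 1 v + sqsin (pcoord 0 (repr q))) * pcoord 1 xi) =
      pcoord 0 xi \*: pcoord 0 +
      pcoord 1 xi \*: (pcoord 1 + cst (sqsin (pcoord 0 (repr q)))).
      by apply/funext => y /=; rewrite mulrC [X in _ + X]mulrC.
    by rewrite derive_val addr0 !expr2.
  rewrite lt_neqAle addr_ge0 ?sqr_ge0// andbT eq_sym paddr_eq0 ?sqr_ge0//.
  rewrite !sqrf_eq0; apply/negP => /andP[/eqP x0 /eqP x1].
  by move/eqP: xi0; apply; apply: pcoord_ext; rewrite ?x0 ?x1 linear0.
(* Since the potential lies in [0, 1], [lag q v] is at least |v|^2 / 2 - |v|, which exceeds A |v|
   once |v| > 2 (|A| + 1). *)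
- move=> q A; exists (2 * (`|A| + 1)) => v vA.
  have A0 : 0 <= `|A| by [].
  have AA : A <= `|A| by rewrite ler_norm.
  have v0 : 0 < `|v| by lra.
  rewrite ltr_pdivlMr// /lag.
  (* The norm is the maximum norm, hence bounded by the Euclidean one. *)
  have [i vi] : exists i, `|v| = `|pcoord i v|.
    by apply: norm_pcoord; rewrite -normr_gt0.
  have v2 : `|v| ^+ 2 <= pcoord 0 v ^+ 2 + pcoord 1 v ^+ 2.
    rewrite vi real_normK ?num_real//.
    by have [->|->] := ord2_cases i; rewrite ?lerDl ?lerDr sqr_ge0.
  have v1 := pcoord_norm v 1.
  have b0 := sqsin_ge0 (pcoord 0 (repr q)); have b1 := sqsin_le1 (pcoord 0 (repr q)).
  have bv : - `|v| <= sqsin (pcoord 0 (repr q)) * pcoord 1 v.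
    move: v1; rewrite ler_norml => /andP[]; nra.
  nra.
Qed.

End Lagrangian.

(** * Conservation laws and the obstruction to travelling between the circles *)

Section Orbits.
Context {R : realType}.
Local Notation V := 'rV[R]_2.


(** Gronwall run backwards: y^2 exp (2 C t) is nondecreasing, as y y' + C y^2 >= 0, so its vanishing
    at [T] forces its vanishing at 0. *)
Lemma gronwall_zero (y dy : R -> R) (T C : R) :
  0 < T -> {within `[0, T], continuous y} ->
  (forall t : R, t \in `]0, T[ -> is_derive t 1 y (dy t)) ->
  (forall t : R, t \in `]0, T[ -> `|dy t| <= C * `|y t|) ->
  y T = 0 -> y 0 = 0.
Proof.
move=> T0 cy yE dyC yT.
pose e (t : R) := expR (2 * C * t).
pose u := y * y * e.
have de (t : R) : is_derive t (1 : R) e (2 * C * e t).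
  have dl : is_derive t (1 : R) (2 * C \*: (id : R -> R)) (2 * C).
    by apply: is_derive_eq; rewrite [_ *: 1]mulr1.
  rewrite [2 * C * _]mulrC.
  exact: (@is_derive1_comp R expR (2 * C \*: id) t _ _ (is_derive_expR _) dl).
have du (t : R) : t \in `]0, T[ ->
    is_derive t (1 : R) u (2 * (y t * dy t + C * y t ^+ 2) * e t).
  move=> t0T; have := yE t t0T => dyt; have := de t => det.
  have -> : 2 * (y t * dy t + C * y t ^+ 2) * e t
      = y t * y t * (2 * C * e t) + e t * (y t * dy t + y t * dy t) by ring.
  exact: is_deriveM.
have cu : {within `[0, T], continuous u}.
  have ce : {within `[0, T], continuous e}.
    apply: continuous_subspaceT => t; apply: differentiable_continuous.
    by apply/derivable1_diffP; exact: ex_derive.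
  by move=> t; apply: continuousM; [apply: continuousM; exact: cy|exact: ce].
have /(_ 0 T) : {in `[0, T] &, {homo u : a b / a <= b}}.
  apply: ger0_derive1_le_cc cu.
  - by move=> t /du[].
  - move=> t t0T; have /du := t0T => dut; rewrite derive1E derive_val.
    rewrite mulr_ge0 ?expR_ge0// mulr_ge0//.
    have := ler_norm (- (y t * dy t)).
    rewrite normrN normrM -[y t ^+ 2]real_normK ?num_real// => h1.
    have : `|y t| * `|dy t| <= `|y t| * (C * `|y t|).
      by rewrite ler_wpM2l// dyC.
    by nra.
rewrite !in_itv/= !lexx (ltW T0)/= => /(_ isT isT isT).
have uE t : u t = y t ^+ 2 * e t by rewrite expr2.
rewrite !uE yT expr0n mul0r pmulr_lle0 ?expR_gt0// => y0.
by apply/eqP; rewrite -sqrf_eq0 eq_le y0 sqr_ge0.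
Qed.

Lemma constant_of_derive0 (y : R -> R) (T : R) :
  {within `[0, T], continuous y} ->
  (forall t : R, t \in `]0, T[ -> is_derive t 1 y 0) ->
  forall t : R, t \in `[0, T] -> y t = y 0.
Proof.
move=> cy yE t; rewrite in_itv/= => /andP[t0 tT].
have [s st||s _ /eqP] := @MVT_segment R y (fun=> 0) 0 t t0.
- by apply: yE; move: st; rewrite !in_itv/= => /andP[-> /lt_le_trans->].
- by apply: continuous_subspaceW cy; apply: subset_itvl; rewrite bnd_simp.
- by rewrite mul0r subr_eq0 => /eqP.
Qed.

Lemma is_derive_pcoord_comp i (x : R -> V) (t : R) w :
  is_derive t 1 x w -> is_derive t 1 (pcoord i \o x) (pcoord i w).
Proof.
move=> [dx xE].
have dxd : differentiable x t by apply/derivable1_diffP.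
have dp : differentiable (pcoord i : V -> R) (x t).
  exact/linear_differentiable/pcoord_continuous.
have dc : differentiable (pcoord i \o x) t by exact: differentiable_comp.
split; first exact: diff_derivable.
rewrite deriveE// diff_comp//= diff_lin; last exact: pcoord_continuous.
by rewrite -deriveE// xE.
Qed.

Lemma continuous_within_comp {U W : topologicalType} (A : set R) (f : R -> U)
    (g : U -> W) :
  continuous g -> {within A, continuous f} -> {within A, continuous (g \o f)}.
Proof. by move=> cg; apply: within_continuous_comp => y _; exact: cg. Qed.

Lemma sqsin_continuous : continuous (@sqsin R).
Proof.
move=> a; rewrite /sqsin.
apply: (@continuous_comp _ _ _ (fun a => sin (pi * a)) (fun s => s ^+ 2)).
  apply: (@continuous_comp _ _ _ (fun a => pi * a) sin); last exact: continuous_sin.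
  exact: mulrl_continuous.
exact: exprn_continuous.
Qed.

(** This is the Euler-Lagrange equation in the cyclic direction [pt 0 1]; continuity carries it to
    the endpoints. *)
Lemma momentum_conserved (T : R) (x w : R -> V) : EL_orbit lag T x w ->
  forall t : R, t \in `[0, T] ->
    pcoord 1 (w t) + sqsin (pcoord 0 (x t)) =
    pcoord 1 (w 0) + sqsin (pcoord 0 (x 0)).
Proof.
move=> [cx cw xE EL].
apply: (@constant_of_derive0 (fun t => pcoord 1 (w t) + sqsin (pcoord 0 (x t)))).
  have cx0 := continuous_within_comp _ _ _ (@pcoord_continuous R 0) cx.
  have cw1 := continuous_within_comp _ _ _ (@pcoord_continuous R 1) cw.
  have cs := continuous_within_comp _ _ _ sqsin_continuous cx0.
  exact: within_continuousD cw1 cs.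
move=> t /EL/(_ (pt 0 1)); rewrite dqL_lag.
rewrite (_ : (fun s => dvL _ _ _ _) = fun s => pcoord 1 (w s) + sqsin (pcoord 0 (x s)))//.
by apply/funext => s; rewrite dvL_lag pt0 pt1 mulr0 add0r mulr1.
Qed.

Lemma cos_piMint (m : int) : cos (pi * m%:~R : R) != 0.
Proof.
have /eqP : sqsin (m%:~R : R) = 0.
  by rewrite -[m%:~R]add0r sqsinDint /sqsin mulr0 sin0 expr0n.
by apply: contraTneq => c0; rewrite sqsin_cos c0 expr0n subr0 oner_neq0.
Qed.

(** The first alternative serves connecting orbits below the critical value 1/2, the second
    arbitrary orbits with k <= 1/8. *)
Lemma orbit_not_reaching (T k : R) (x w : R -> V) (m n : int) :
  0 < T -> EL_orbit lag T x w -> has_energy lag T k x w ->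
  pcoord 0 (x 0) = m%:~R -> pcoord 0 (x T) = 2^-1 + n%:~R ->
  (pcoord 1 (w 0) = 0 /\ 2 * k <= 1) \/ 2 * k <= 4^-1 -> False.
Proof.
move=> T0 orb en x0 xT Hk; have [cx cw xE EL] := orb.
have s0 : sqsin (pcoord 0 (x 0)) = 0.
  by rewrite x0 -[m%:~R]add0r sqsinDint /sqsin mulr0 sin0 expr0n.
have sT : sqsin (pcoord 0 (x T)) = 1.
  by rewrite xT sqsinDint /sqsin sin_pihalf expr1n.
have in0 : 0 \in `[0, T] by rewrite in_itv/= lexx ltW.
have inT : T \in `[0, T] by rewrite in_itv/= lexx ltW.
have mom := @momentum_conserved T x w orb.
rewrite s0 addr0 in mom.
(* The potential vanishes at time 0, so the momentum P is [pcoord 1 (w 0)]. *)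
have nrg t : t \in `[0, T] ->
    pcoord 0 (w t) ^+ 2 + (pcoord 1 (w 0) - sqsin (pcoord 0 (x t))) ^+ 2 = 2 * k.
  move=> tT; rewrite -(en t tT) energy_lag -(mom t tT) addrK.
  by rewrite mulrA mulfV ?mul1r// pnatr_eq0.
have speed t : t \in `[0, T] ->
    pcoord 0 (w t) ^+ 2 <= 2 * cos (pi * pcoord 0 (x t)) ^+ 2.
  move=> tT; have := nrg t tT; have := nrg _ in0; have := nrg _ inT.
  rewrite s0 sT.
  have := sqsin_ge0 (pcoord 0 (x t)); have := sqsin_le1 (pcoord 0 (x t)).
  have -> : cos (pi * pcoord 0 (x t)) ^+ 2 = 1 - sqsin (pcoord 0 (x t)).
    by rewrite sqsin_cos opprB addrC subrK.
  move: (sqsin _) => s s1 s0' e1 e2 e3.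
  have q0 := sqr_ge0 (pcoord 0 (w 0)); have qT := sqr_ge0 (pcoord 0 (w T)).
  (* With P = 0, the squared speed is at most 1 - s^2 = (1 - s) (1 + s) <= 2 (1 - s). *)
  case: Hk => [[P0 k1]|k1]; first by rewrite P0 in e1 e2 e3; nra.
  (* The energy at the two ends gives P^2 <= 2k and (P - 1)^2 <= 2k; with 2k <= 1/4 both hold only
     for P = 1/2. The squared speed is then at most s (1 - s). *)
  have P2 : pcoord 1 (w 0) = 2^-1 by nra.
  by rewrite P2 in e1 e2 e3; nra.
pose y t := cos (pi * pcoord 0 (x t)).
pose dy t := - (pi * pcoord 0 (w t) * sin (pi * pcoord 0 (x t))).
have /eqP : y 0 = 0.
  (* The speed bound gives |y'| <= sqrt 2 pi |y|; the rounder constant 2 pi lets the comparison be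
     made on squares. *)
  apply: (@gronwall_zero y dy T (2 * pi)) => //.
  - have cx0 := continuous_within_comp _ _ _ (@pcoord_continuous R 0) cx.
    have cpx := continuous_within_comp _ _ _ (@mulrl_continuous R pi) cx0.
    exact: continuous_within_comp _ _ _ (@continuous_cos R) cpx.
  - move=> t tT.
    have dx := @is_derive_pcoord_comp 0 x t (w t) (xE t tT).
    have dpx : is_derive t (1 : R) (pi \*: (pcoord 0 \o x)) (pi * pcoord 0 (w t)).
      exact: is_deriveZ.
    have -> : dy t = - sin (pi * pcoord 0 (x t)) * (pi * pcoord 0 (w t)).
      by rewrite /dy mulNr mulrC.
    exact: (@is_derive1_comp R cos (pi \*: (pcoord 0 \o x)) t _ _ (is_derive_cos _) dpx).
  - move=> t tT; rewrite -(@ler_pXn2r _ 2) ?nnegrE ?mulr_ge0 ?pi_ge0//.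
    rewrite exprMn !real_normK ?num_real// /dy sqrrN !exprMn.
    have := speed t (subset_itv_oo_cc tT).
    have := sqsin_le1 (pcoord 0 (x t)); rewrite /sqsin /y.
    have := sqr_ge0 (sin (pi * pcoord 0 (x t))).
    have := sqr_ge0 (pcoord 0 (w t)).
    have := sqr_ge0 (cos (pi * pcoord 0 (x t))).
    have := sqr_ge0 (pi : R).
    move: (_ ^+ 2) (sin _ ^+ 2) (cos _ ^+ 2) (pcoord 0 (w t) ^+ 2)
      => P S c W P0 C0 W0 S0 S1 WC.
    have h1 : W * S <= 2 * c by nra.
    have h2 : P * (W * S) <= P * (2 * c) by rewrite ler_wpM2l.
    have h3 : 0 <= P * c by rewrite mulr_ge0.
    by nra.
  - apply/eqP; rewrite -sqrf_eq0 /y.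
    have /eqP := sT; rewrite sqsin_cos eq_sym -subr_eq0 opprB addrC subrK.
    by [].
by apply/negP; rewrite /y x0 cos_piMint.
Qed.

End Orbits.

(** * Bounds on the two critical values *)

Section CriticalValues.
Context {R : realType}.
Local Notation V := 'rV[R]_2.

(** Together with the lower bound below, this reduces everything to pointwise inequalities, so the
    Hamiltonian is never computed. *)
Lemma critical_value_cover_le (L : torus R -> V -> R) (G : set 'rV[int]_2)
    (u : V -> R) (c : R) :
  smooth_invariant G u ->
  (forall x v, 'd u x v - L (tpi x) v <= c) ->
  (critical_value_cover L G <= c%:E)%E.
Proof.
move=> Gu uc; apply: (@le_trans _ _ (ereal_sup
    [set hamiltonian L (tpi x) ('d u x) | x in setT])).
  by apply: ereal_inf_lbound; exists u.
apply: ge_ereal_sup => _ [x _ <-]; apply: ge_ereal_sup => _ [v _ <-].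
by rewrite lee_fin.
Qed.

Lemma critical_value_cover_ge (L : torus R -> V -> R) (G : set 'rV[int]_2)
    (c : R) :
  (forall u : V -> R, smooth_invariant G u ->
    exists x v, c <= 'd u x v - L (tpi x) v) ->
  (c%:E <= critical_value_cover L G)%E.
Proof.
move=> Gc; apply: le_ereal_inf_tmp => _ [u Gu <-]; have [x [v cE]] := Gc u Gu.
apply: (@le_trans _ _ (hamiltonian L (tpi x) ('d u x))).
  apply: (@le_trans _ _ ('d u x v - L (tpi x) v)%:E); first by rewrite lee_fin.
  by apply: ereal_sup_ubound; exists v.
by apply: ereal_sup_ubound; exists x.
Qed.

Lemma universal_critical_value_lag :
  (universal_critical_value lag <= (8^-1 : R)%:E)%E.
Proof.
(* The slope 1/2 is the midpoint of the range [0, 1] of the potential. This [u] is not periodic, but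
   only the zero translation acts here. *)
pose u : {linear V -> R} := 2^-1 \*: pcoord 1.
have cu : continuous u.
  by move=> x; apply: (@continuousZl_tmp _ _ _ (pcoord 1)); exact: pcoord_continuous.
apply: (@critical_value_cover_le _ _ u).
  split; first exact: smooth_linear.
  by move=> _ x ->; rewrite /intv map_mx0 addr0.
move=> x v; rewrite diff_lin// lagE (_ : u v = 2^-1 * pcoord 1 v)//.
have := sqsin_ge0 (pcoord 0 x); have := sqsin_le1 (pcoord 0 x).
move: (sqsin _) (pcoord 0 v) (pcoord 1 v) => s a b s1 s0.
(* Completing the square in b leaves (1/2 - s)^2 / 2 = 1/8 - s (1 - s) / 2. *)
have := sqr_ge0 a; have := sqr_ge0 (b + s - 2^-1).
have : 0 <= s * (1 - s) by nra.
rewrite !expr2; lra.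
Qed.

Lemma critical_value_lag_le (Q0 Q1 : set (torus R)) :
  (critical_value lag Q0 Q1 <= (2^-1 : R)%:E)%E.
Proof.
apply: (@critical_value_cover_le _ _ (cst 0)).
  by split; first exact: smooth_cst.
move=> x v; rewrite (_ : 'd (cst 0) x v = 0) ?diff_cst// lagE.
have := sqsin_ge0 (pcoord 0 x); have := sqsin_le1 (pcoord 0 x).
move: (sqsin _) (pcoord 0 v) (pcoord 1 v) => s a b s1 s0.
have := sqr_ge0 a; have := sqr_ge0 (b + s).
have : s * s <= 1 by nra.
rewrite !expr2; lra.
Qed.

Lemma critical_value_lag_ge (a : R) (Q1 : set (torus R)) :
  ((2^-1 : R)%:E <= critical_value lag (circle a) Q1)%E.
Proof.
apply: critical_value_cover_ge => u [su Gu].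
(* The circle itself is a loop of class (0, 1), so [u] has period 1 in the second coordinate and
   Rolle applies along the line of first coordinate 1/2. *)
pose m : 'rV[int]_2 := \row_j (if j == 0 then 0 else 1).
have mE : intv R m = pt 0 1.
  by apply: pcoord_ext; rewrite pcoord_intv mxE ?pt0 ?pt1.
have Gm : pi1_normal_closure (circle a) Q1 m.
  apply: sub_gen_smallest; left; exists (pt a); split.
  - exact/continuous_subspaceT/pt_continuous.
  - by move=> t t01; exists t.
  - by apply: pcoord_ext; rewrite linearD/= mE ?pt0 ?pt1 ?addr0 ?add0r.
have du x : differentiable u x by case: (su 1%N) => du _; exact: du.
pose g (t : R) := u (pt 2^-1 0 + t *: pt 0 1).
have dg t : is_derive t (1 : R) g ('d u (pt 2^-1 0 + t *: pt 0 1) (pt 0 1)).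
  have [dl lE] := is_derive_line (pt 2^-1 0) (pt 0 1) t.
  have dl' : differentiable (fun s : R => pt 2^-1 0 + s *: pt 0 1 : V) t.
    exact/derivable1_diffP.
  have dgt : differentiable g t by apply: (@differentiable_comp _ _ _ _ _ u).
  split; first exact: diff_derivable.
  by rewrite deriveE// (@diff_comp _ _ _ _ _ u)//= -[X in 'd u _ X = _]deriveE// lE.
have [| | |t _ t0] := @Rolle R g 0 1 ltr01.
- by move=> t _; case: (dg t).
- apply: continuous_subspaceT => t; apply: differentiable_continuous.
  by apply/derivable1_diffP; case: (dg t).
- by rewrite /g scale0r addr0 scale1r -mE Gu.
(* The potential is 1 on this line, so the velocity (0, -1) gives -L = -1/2 + 1 = 1/2, and [u]
   contributes nothing in that direction. *)
exists (pt 2^-1 0 + t *: pt 0 1), (- pt 0 1).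
have -> : 'd u (pt 2^-1 0 + t *: pt 0 1) (- pt 0 1) = 0 :> R.
  rewrite linearN /=; have [_ <-] := dg t; case: t0 => _ ->; exact: oppr0.
rewrite lagE (_ : pcoord 0 (_ + _) = 2^-1); last first.
  by rewrite linearD linearZ/= !pt0 [_ *: 0]mulr0 addr0.
have pN i : pcoord i (- pt 0 1 : V) = - pcoord i (pt 0 1) by exact: linearN.
rewrite !pN pt0 pt1 /sqsin sin_pihalf; lra.
Qed.

End CriticalValues.

(** * Assembly of the example *)

Theorem theorem2 (R : realType) :
  exists (L : torus R -> 'rV[R]_2 -> R) (Q0 Q1 : set (torus R)),
    [/\ tonelli L,
        closed_connected_submanifold Q0 /\ closed_connected_submanifold Q1,
        Q0 !=set0 /\ Q1 !=set0 &
        Q0 `&` Q1 = set0] /\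
    [/\ (universal_critical_value L < critical_value L Q0 Q1)%E,
        forall k : R, (k%:E <= critical_value L Q0 Q1)%E ->
          ~ exists (T : R) (x w : R -> 'rV[R]_2),
              connecting_orbit L Q0 Q1 T x w /\ has_energy L T k x w &
        exists q0 q1 : torus R,
          [/\ Q0 q0, Q1 q1 &
            forall k : R, (k%:E <= universal_critical_value L)%E ->
              ~ exists (T : R) (x w : R -> 'rV[R]_2),
                  [/\ 0 < T, EL_orbit L T x w,
                      tpi (x 0) = q0 /\ tpi (x T) = q1 &
                      has_energy L T k x w]]].
Proof.
have circle0 (a : R) : circle a (tpi (pt a 0)).
  by apply/circleP; exists 0; rewrite pt0 addr0.
exists lag, (circle 0), (circle 2^-1); split; split.
- exact: lag_tonelli.
- by split; exact: circle_submanifold.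
- by split; [exists (tpi (pt 0 0))|exists (tpi (pt 2^-1 0))]; exact: circle0.
- apply/seteqP; split=> // q []; have [x ->] := tpi_surj q.
  move=> /circleP[m xm] /circleP[n]; rewrite xm add0r => mn.
  (* A common point would make 1/2 a difference of integers; doubling turns this into a parity
     contradiction. *)
  have : 2 * (m - n) = 1 :> int.
    apply/eqP; rewrite -(@eqr_int R) intrM intrB mn addrK mulfV//.
  lia.
- apply: le_lt_trans (universal_critical_value_lag) _.
  apply: lt_le_trans (critical_value_lag_ge 0 _).
  by rewrite lte_fin; lra.
- move=> k /le_trans/(_ (critical_value_lag_le _ _)); rewrite lee_fin => k2.
  move=> [T [x [w [[T0 orb [x0 xT] c0 _] en]]]].
  have [[m x0E] [n xTE]] := (proj1 (circleP 0 _) x0, proj1 (circleP _ _) xT).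
  rewrite add0r in x0E.
  apply: (orbit_not_reaching T k x w m n) => //; left; split; last by lra.
  (* Conormality tested on the tangent vector of the first circle says P = 0, and the potential
     vanishes there, so [pcoord 1 (w 0)] is 0. *)
  have := c0 _ (circle_tangent 0 (x 0) x0).
  rewrite dvL_lag pt0 pt1 mulr0 add0r mulr1 => /eqP.
  rewrite addr_eq0 => /eqP ->; rewrite x0E -[m%:~R]add0r sqsinDint /sqsin mulr0 sin0.
  by rewrite expr0n oppr0.
(* Any point on each circle would do: the obstruction sees only first coordinates. *)
- exists (tpi (pt 0 0)), (tpi (pt 2^-1 0)); split; try exact: circle0.
  move=> k /le_trans/(_ universal_critical_value_lag); rewrite lee_fin => k8.
  move=> [T [x [w [T0 orb [x0 xT] en]]]].
  have /circleP[m x0E] : circle 0 (tpi (x 0)) by rewrite x0; exact: circle0.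
  have /circleP[n xTE] : circle 2^-1 (tpi (x T)) by rewrite xT; exact: circle0.
  rewrite add0r in x0E.
  by apply: (orbit_not_reaching T k x w m n) => //; right; lra.
Qed.
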